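(* Let $(Y,\gamma)$ be a GTspace. Then the following are equivalent. (1) $(Y,\gamma)$ is $s\lambda$-regular. (2) For each point $y\in Y$ and each $s\lambda$-open set $G$ containing $y$, there exists an $s\lambda$-open set $E$ such that $y\in E\subset \mathrm{cl}_{s\lambda}(E)\subset G$. (3) For each $s\lambda$-closed set $P$ of $Y$, $\bigcap\{\mathrm{cl}_{s\lambda}(F): P\subset F,\ F \text{ is } s\lambda\text{-open}\}=P$. (4) For each subset $D\subset Y$ and each $s\lambda$-open set $E$ such that $D\cap E\neq\emptyset$, there exists an $s\lambda$-open set $F$ such that $D\cap F\neq\emptyset$ and $\mathrm{cl}_{s\lambda}(F)\subset E$. (5) For each nonempty subset $D\subset Y$ and each $s\lambda$-closed set $P\subset Y$ such that $D\cap P=\emptyset$, there exist $s\lambda$-open sets $M,N$ such that $D\cap M\neq\emptyset$, $P\subset N$ and $M\cap N=\emptyset$. (6) For each $s\lambda$-closed set $P\subset Y$ and each $y\in Y$ with $y\notin P$, there exist an $s\lambda$-open set $E$ and an $sg_\lambda$-open set $F$ such that $y\in E$, $P\subset F$ and $E\cap F=\emptyset$. (7) For each nonempty subset $D\subset Y$ and each $s\lambda$-closed set $P\subset Y$ such that $D\cap P=\emptyset$, there exist an $s\lambda$-open set $E$ and an $sg_\lambda$-open set $F$ such that $D\cap E\neq\emptyset$, $P\subset F$ and $E\cap F=\emptyset$. (8) For each $s\lambda$-closed set $P$ of $Y$ and each point $y\in Y$ with $y\notin P$, there exist $s\lambda$-open sets $E,F$ such that $y\in E$, $P\subset F$ and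 $E\cap F=\emptyset$.
   Context: A generalized topology on a nonempty set $Y$ is a collection $\gamma$ of subsets of $Y$ with $\emptyset\in\gamma$ that is closed under arbitrary unions; $(Y,\gamma)$ is then called a GTspace (it is not required that $Y\in\gamma$, nor closure under finite intersections). Members of $\gamma$ are called $\gamma$-open and their complements $\gamma$-closed; the $\gamma$-closure $\overline{D}_\gamma$ of $D\subset Y$ is the intersection of all $\gamma$-closed sets containing $D$. A set $D\subset Y$ is $s\gamma$-open if there is a $\gamma$-open set $V$ with $V\subset D\subset\overline{V}_\gamma$; $D$ is $s\gamma$-closed if $Y-D$ is $s\gamma$-open. $\mathrm{sker}_\gamma(D)$ is the intersection of all $s\gamma$-open sets containing $D$. A set $D\subset Y$ is $s\lambda$-closed if $D=M\cap N$ for some $M$ with $M=\mathrm{sker}_\gamma(M)$ and some $s\gamma$-closed set $N$; $D$ is $s\lambda$-open if $Y-D$ is $s\lambda$-closed. The $s\lambda$-closure $\mathrm{cl}_{s\lambda}(D)$ is the set of all $y\in Y$ such that every $s\lambda$-open set containing $y$ meets $D$. A set $D\subset Y$ is $sg_\lambda$-closed if $\mathrm{cl}_{s\lambda}(D)\subset V$ whenever $D\subset V$ and $V$ is $s\lambda$-open; $D$ is $sg_\lambda$-open if $Y-D$ is $sg_\lambda$-closed. $(Y,\gamma)$ is $s\lambda$-regular if for every $s\lambda$-closed set $A$ and every point $p\in Y$ with $p\notin A$ there exist $s\lambda$-open sets $E,F$ with $A\subset E$, $p\in F$ and $\mathrm{cl}_{s\lambda}(E)\cap\mathrm{cl}_{s\lambda}(F)=\emptyset$.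 *)

(* Defs.v *)
From mathcomp Require Import all_boot.
From mathcomp Require Import boolp classical_sets.

Set Implicit Arguments.
Unset Strict Implicit.
Unset Printing Implicit Defensive.

Local Open Scope classical_set_scope.

(* The whole space need not be open, and intersections of open sets need not
   be open. *)
Record generalized_topology (Y : Type) (g : set (set Y)) : Prop :=
  GeneralizedTopology {
    gt_open0 : g set0;
    gt_openU : forall C : set (set Y), C `<=` g -> g (\bigcup_(V in C) V) }.

Record gtspace (Y : Type) (g : set (set Y)) : Prop := GTspace {
    gt_nonempty : [set: Y] !=set0;
    gt_topology : generalized_topology g }.

Section Notions.
Context (Y : Type) (g : set (set Y)).
Implicit Types (A D E F G M N P V : set Y) (p y : Y).

Definition g_closed D : Prop := g (~` D).

(* [smallest C D] is by definition the intersection of all the sets in the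
   class C that contain D (the whole space if there is none); it need not itself
   belong to C. *)
Definition g_closure D : set Y := smallest g_closed D.

Definition s_open D : Prop := exists V, [/\ g V, V `<=` D & D `<=` g_closure V].

Definition s_closed D : Prop := s_open (~` D).

Definition sker D : set Y := smallest s_open D.

Definition sl_closed D : Prop :=
  exists M N, [/\ M = sker M, s_closed N & D = M `&` N].

Definition sl_open D : Prop := sl_closed (~` D).

Definition sl_closure D : set Y :=
  [set y | forall V, sl_open V -> V y -> V `&` D !=set0].

Definition sgl_closed D : Prop :=
  forall V, sl_open V -> D `<=` V -> sl_closure D `<=` V.

Definition sgl_open D : Prop := sgl_closed (~` D).

Definition sl_regular : Prop :=
  forall A p, sl_closed A -> ~ A p ->
    exists E F, [/\ sl_open E, sl_open F, A `<=` E, F p &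
      sl_closure E `&` sl_closure F = set0].

End Notions.

(* Main.v *)
Require Import Defs.
From mathcomp Require Import all_boot.
From mathcomp Require Import boolp classical_sets.

(** The argument is the usual one for regularity in a topological space, and
    what has to be checked is that it survives in a setting without finite
    intersections.  Three facts carry it.

    The s-lambda-closure of [D] is the intersection of [sker D] with the
    intersection [smallest s_closed D] of the s-closed sets containing [D]
    ([sl_closureE]): each s-lambda-closed superset [M `&` N] of [D] contains
    both, because [M] is a kernel and [N] is s-closed, while s-open sets and
    s-closed sets are themselves s-lambda-closed.  Semi-open sets are stable
    under arbitrary unions, so this intersection is of the form [M `&` N] and
    [sl_closure D] is s-lambda-closed ([sl_closed_closure]).

    An s-lambda-open set disjoint from [D] is disjoint from the closure of [D]
    ([sl_closure_disjoint]).  With the previous fact, passing to complements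
    turns an open set whose closure lies in [G] into a pair of disjoint open
    sets, and back.

    An sg-lambda-open set [F] containing an s-lambda-closed set [P] contains an
    s-lambda-open set that still contains [P], namely the complement of the
    closure of [~` F] ([sgl_open_interior]).  Hence a
    separation in which [P] lies in an sg-lambda-open set can be improved to one
    in which it lies in an s-lambda-open set.

    The conditions that quantify over a set [D] reduce to those about a point by
    choosing a point of [D] in one direction and a singleton in the other.  The
    strong form of regularity, with disjoint closures, comes from separating
    twice: once to obtain an open set around the point whose closure misses the
    closed set, and a second time inside that open set. *)

Set Implicit Arguments.
Unset Strict Implicit.
Unset Printing Implicit Defensive.

Local Open Scope classical_set_scope.

Section Closure.
Context (Y : Type) (g : set (set Y)) (hg : generalized_topology g).
Implicit Types (A D E F G P U V : set Y) (p y : Y).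

Lemma g_closureS D E : D `<=` E -> g_closure g D `<=` g_closure g E.
Proof. by move=> DE y Dy C [Cc EC]; apply: Dy; split=> // z /DE /EC. Qed.

(** The witness is the union of all open sets inside the union of the family;
    taking all of them avoids choosing one for each member. *)
Lemma s_open_bigcup (I : Type) (C : set I) (U : I -> set Y) :
  (forall i, C i -> s_open g (U i)) -> s_open g (\bigcup_(i in C) U i).
Proof.
move=> Us; set W := \bigcup_(i in C) U i.
exists (\bigcup_(V in [set V | g V /\ V `<=` W]) V); split.
- by apply: (gt_openU hg) => V [].
- by move=> y [V [_ VW] Vy]; exact: VW.
- move=> y [i Ci Uy]; have [V [gV VU UV]] := Us _ Ci.
  apply: (g_closureS _ (UV _ Uy)) => z Vz; exists V => //.
  by split=> // t /VU Ut; exists i.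
Qed.

Lemma s_open0 : s_open g set0.
Proof. by exists set0; split=> //; exact: gt_open0 hg. Qed.

Lemma s_closed_smallest D : s_closed g (smallest (s_closed g) D).
Proof.
rewrite /s_closed /smallest setC_bigcap.
by apply: s_open_bigcup => A [].
Qed.

Lemma sker_idem D : sker g (sker g D) = sker g D.
Proof.
apply/seteqP; split=> [y Ky U [sU DU] | y Dy U [_]]; last exact.
by apply: Ky; split=> // z; apply.
Qed.

Lemma sker_s_open U : s_open g U -> sker g U = U.
Proof.
move=> sU; apply/seteqP; split=> [y Ky | y Uy V [_ UV]]; last exact: UV.
by apply: Ky; split.
Qed.

Lemma sl_closed_s_open U : s_open g U -> sl_closed g U.
Proof.
move=> sU; exists U, setT; split; last by rewrite setIT.
- by rewrite sker_s_open.
- by rewrite /s_closed setCT; exact: s_open0.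
Qed.

Lemma sl_closed_s_closed N : s_closed g N -> sl_closed g N.
Proof.
move=> sN; exists setT, N; split=> //; last by rewrite setTI.
by apply/seteqP; split=> // y _ V [_]; exact.
Qed.

Lemma sub_sl_closure D : D `<=` sl_closure g D.
Proof. by move=> y Dy V _ Vy; exists y. Qed.

Lemma sl_openC A : sl_closed g A -> sl_open g (~` A).
Proof. by rewrite /sl_open setCK. Qed.

Lemma sl_closure_disjoint D V :
  sl_open g V -> V `&` D = set0 -> V `&` sl_closure g D = set0.
Proof.
move=> oV VD; apply/seteqP; split=> // y [Vy /(_ V oV Vy)].
by rewrite VD => -[].
Qed.

Lemma sl_closure_min D A : sl_closed g A -> D `<=` A -> sl_closure g D `<=` A.
Proof.
move=> cA DA y cDy; apply: contrapT => nAy.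
by have [z [nAz /DA]] := cDy _ (sl_openC cA) nAy.
Qed.

(** The two factors are the least kernel and the least s-closed set containing
    [D], so they lie below the two factors of any s-lambda-closed superset. *)
Lemma sl_closureE D :
  sl_closure g D = sker g D `&` smallest (s_closed g) D.
Proof.
apply/seteqP; split=> [y cDy | y [Ky Sy] V [M [N [MK sN VE]]] Vy].
  split=> A [sA DA]; apply: sl_closure_min cDy => //.
  - exact: sl_closed_s_open.
  - exact: sl_closed_s_closed.
apply: contrapT => VD0.
have DV : D `<=` M `&` N.
  by rewrite -VE => z Dz Vz; apply: VD0; exists z.
suff : (~` V) y by [].
rewrite VE; split; last by apply: Sy; split=> // z /DV[].
by rewrite MK => U [sU MU]; apply: Ky; split=> // z /DV[/MU].
Qed.

Lemma sl_closed_closure D : sl_closed g (sl_closure g D).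
Proof.
exists (sker g D), (smallest (s_closed g) D).
by rewrite sker_idem sl_closureE; split=> //; exact: s_closed_smallest.
Qed.

Lemma sl_open_exterior D : sl_open g (~` sl_closure g D).
Proof. exact/sl_openC/sl_closed_closure. Qed.

(** Turns an open set [F] around a closed set [P] into an open set whose closure
    misses [P]; the points lying in it are those outside the closure of [F]. *)
Lemma sl_closure_exterior F :
  sl_open g F -> sl_closure g (~` sl_closure g F) `<=` ~` F.
Proof.
by move=> oF; apply: sl_closure_min => // y; apply: contra_not; exact: sub_sl_closure.
Qed.

Lemma sl_open_sgl_open V : sl_open g V -> sgl_open g V.
Proof. by move=> oV W _ VW; apply: subset_trans VW; exact: sl_closure_min. Qed.

(** The defining property of the sg-lambda-closed set [~` F], applied to its
    open superset [~` P], says that its closure misses [P]. *)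
Lemma sgl_open_interior P F : sl_closed g P -> sgl_open g F -> P `<=` F ->
  exists V, [/\ sl_open g V, P `<=` V & V `<=` F].
Proof.
move=> cP oF PF; exists (~` sl_closure g (~` F)); split.
- exact: sl_open_exterior.
- have sub := oF _ (sl_openC cP) (subsetC PF).
  by move=> y Py /sub.
- by move=> y ny; apply: contrapT => nFy; apply: ny; exact: sub_sl_closure.
Qed.

End Closure.

Theorem theorem3p3 (Y : Type) (g : set (set Y)) (hY : gtspace g) :
  [<->
    (* 1 *) sl_regular g;
    (* 2 *) forall (y : Y) (G : set Y), sl_open g G -> G y ->
      exists E : set Y, [/\ sl_open g E, E y, E `<=` sl_closure g E &
        sl_closure g E `<=` G];
    (* 3 *) forall P : set Y, sl_closed g P ->
      \bigcap_(F in [set F : set Y | P `<=` F /\ sl_open g F])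
        sl_closure g F = P;
    (* 4 *) forall D E : set Y, sl_open g E -> D `&` E !=set0 ->
      exists F : set Y, [/\ sl_open g F, D `&` F !=set0 &
        sl_closure g F `<=` E];
    (* 5 *) forall D P : set Y, D !=set0 -> sl_closed g P -> D `&` P = set0 ->
      exists M N : set Y, [/\ sl_open g M, sl_open g N &
        [/\ D `&` M !=set0, P `<=` N & M `&` N = set0]];
    (* 6 *) forall (P : set Y) (y : Y), sl_closed g P -> ~ P y ->
      exists E F : set Y, [/\ sl_open g E, sgl_open g F &
        [/\ E y, P `<=` F & E `&` F = set0]];
    (* 7 *) forall D P : set Y, D !=set0 -> sl_closed g P -> D `&` P = set0 ->
      exists E F : set Y, [/\ sl_open g E, sgl_open g F &
        [/\ D `&` E !=set0, P `<=` F & E `&` F = set0]];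
    (* 8 *) forall (P : set Y) (y : Y), sl_closed g P -> ~ P y ->
      exists E F : set Y, [/\ sl_open g E, sl_open g F &
        [/\ E y, P `<=` F & E `&` F = set0]] ].
Proof.
have hg := gt_topology hY.
tfae.
- move=> reg y G oG Gy.
  have [E [F [_ oF GE Fy cEF0]]] : exists E F, [/\ sl_open g E, sl_open g F,
      ~` G `<=` E, F y & sl_closure g E `&` sl_closure g F = set0].
    by apply: reg => //; exact.
  exists F; split=> //; first exact: sub_sl_closure.
  move=> z cFz; apply: contrapT => /GE Ez.
  by suff : set0 z by []; rewrite -cEF0; split=> //; exact: sub_sl_closure.
- move=> nbh P cP; apply/seteqP; split=> [y capy | y Py F [PF _]].
    apply: contrapT => nPy.
    have [E [oE Ey _ EP]] := nbh y _ (sl_openC cP) nPy.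
    (* the open superset of [P] whose closure misses [y] is the exterior of [E] *)
    apply: (sl_closure_exterior oE _ Ey); apply: capy.
    by split; [move=> z Pz /EP | exact: sl_open_exterior].
  exact/sub_sl_closure/PF.
- move=> capP D E oE [y [Dy Ey]].
  have [F [[EF oF] nFy]] : exists F, (~` E `<=` F /\ sl_open g F) /\
      ~ sl_closure g F y.
    apply: contrapT => noF.
    suff : (~` E) y by [].
    rewrite -(capP _ oE) => F EF; apply: contrapT => nFy.
    by apply: noF; exists F.
  exists (~` sl_closure g F); split; [exact: sl_open_exterior | by exists y |].
  apply: subset_trans (sl_closure_exterior oF) _.
  by move=> z nFz; apply: contrapT => /EF.
- move=> shrink D P [y Dy] cP DP0.
  have [|F [oF DF FP]] := shrink D _ (sl_openC cP).
    by exists y; split=> // Py; suff : set0 y by []; rewrite -DP0.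
  exists F, (~` sl_closure g F); split=> //; first exact: sl_open_exterior.
  split=> //; first by move=> z Pz /FP.
  by apply/seteqP; split=> // z [Fz]; apply; exact: sub_sl_closure.
- move=> sep P y cP nPy.
  have [||M [N [oM oN [[z [-> Mz]] PN MN0]]]] := sep [set y] P _ cP.
  + by exists y.
  + by apply/seteqP; split=> // z [->].
  by exists M, N; split=> //; exact: sl_open_sgl_open.
- move=> sep D P [y Dy] cP DP0.
  have [|E [F [oE oF [Ey PF EF0]]]] := sep P y cP.
    by move=> Py; suff : set0 y by []; rewrite -DP0.
  by exists E, F; split=> //; split=> //; exists y.
- move=> sep P y cP nPy.
  have [||E [F [oE oF [[z [-> Ez]] PF EF0]]]] := sep [set y] P _ cP.
  + by exists y.
  + by apply/seteqP; split=> // z [->].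
  have [V [oV PV VF]] := sgl_open_interior hg cP oF PF.
  exists E, V; split=> //; split=> //.
  by apply: subsetI_eq0 EF0.
- move=> sep A p cA nAp.
  have [E [F [oE oF [Ep AF EF0]]]] := sep A p cA nAp.
  (* separating again, now inside [E], makes room between the two closures *)
  have [|E' [F' [oE' oF' [E'p EF' EF'0]]]] := sep (~` E) p oE; first exact.
  exists F, E'; split=> //.
  have cEF : sl_closure g F `&` E = set0.
    by rewrite setIC; exact: sl_closure_disjoint.
  have cE'F' : F' `&` sl_closure g E' = set0.
    by apply: sl_closure_disjoint => //; rewrite setIC.
  apply/seteqP; split=> // z [cFz cE'z].
  have [Ez | /EF' F'z] := EM (E z).
  + by rewrite -cEF.
  + by rewrite -cE'F'.
Qed.
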